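(* Let $n\notin\{0,1\}$ be real, let $z$ be the deformation parameter, and let $a_1(t),a_2(t)$ be arbitrary real $t$-dependent functions. Consider the deformed complex Bernoulli system $$\frac{\mathrm{d}r}{\mathrm{d}t}=a_1(t)\left(r\cos^2[(n-1)\theta]\,E+\frac{\sin^3[(n-1)\theta]}{z\,r^{n-2}}\,(E-1)\right)+a_2(t)\,r^n\cos[(n-1)\theta],$$ $$\frac{\mathrm{d}\theta}{\mathrm{d}t}=a_1(t)\sin^2[(n-1)\theta]\left(\frac{E}{\tan[(n-1)\theta]}-\frac{\cos[(n-1)\theta]}{z\,r^{n-1}}\,(E-1)\right)+a_2(t)\,r^{n-1}\sin[(n-1)\theta],$$ where $E=\exp\left(\dfrac{z\,r^{n-1}}{\sin[(n-1)\theta]}\right)$. Put $$\gamma(t)=(n-1)\int_a^t a_1(s)\,\mathrm{d}s,\qquad L(t)=\frac{\ln\left(1-zc_1\,\mathrm{e}^{\gamma(t)}\right)}{z},$$ $$\sigma(t)=\int_a^t\frac{(n-1)a_1(u)}{1-zc_1\,\mathrm{e}^{\gamma(u)}}\,\mathrm{d}u,\qquad K(t)=c_2+\int_a^t\mathrm{e}^{\sigma(u)}a_2(u)\,\mathrm{d}u,$$ with integration constants $c_1,c_2$. Then the exact solution of the system is $$r(t)=\bigl(-L(t)\bigr)^{\frac{1}{n-1}}\left\{1+(n-1)^2L(t)^2\,\mathrm{e}^{-2\sigma(t)}K(t)^2\right\}^{\frac{-1}{2(n-1)}},\qquad \theta(t)=\frac{1}{n-1}\arctan\left(\frac{\mathrm{e}^{\sigma(t)}}{(n-1)L(t)K(t)}\right).$$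 In checking that the system is satisfied, only one of the square roots is admissible, namely $\sqrt{(n-1)^2L(t)^2K(t)^2}=(n-1)L(t)K(t)$. In the limit $z\to0$ these expressions reduce to those of the undeformed complex Bernoulli equation.
   Context: The system is the quantum deformation with parameter $z$ of the polar form $\dot r=a_1r+a_2r^n\cos[(n-1)\theta]$, $\dot\theta=a_2r^{n-1}\sin[(n-1)\theta]$ of the complex Bernoulli equation $\dot w=a_1(t)w+a_2(t)w^n$, $w=r\mathrm{e}^{\mathrm{i}\theta}$. Here $a$ is an appropriate real number ensuring that the integrals exist. The solution comes from the change of variables $x=\frac{r^{n-1}}{\sin[(n-1)\theta]}$, $y=\frac{\cos[(n-1)\theta]}{(1-n)r^{n-1}}$, which transforms the system into $\dot x=(n-1)a_1(t)\frac{\mathrm{e}^{zx}-1}{z}$, $\dot y=-(n-1)a_1(t)\mathrm{e}^{zx}y+a_2(t)$. The choice of square root is a consequence of the relation $\sqrt{(n-1)^2x^2y^2}=-(n-1)xy=\frac{1}{\tan[(n-1)\theta]}$. The undeformed solution is $r=\left(c_1\mathrm{e}^{\gamma}\big/\sqrt{1+(n-1)^2c_1^2K_0^2}\right)^{1/(n-1)}$, $\theta=-\frac{1}{n-1}\arctan\left(\frac{1}{(n-1)c_1K_0}\right)$ with $K_0(t)=c_2+\int_a^t\mathrm{e}^{\gamma(s)}a_2(s)\,\mathrm{d}s$.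
   Formalization: The functions a_1, a_2 are taken continuous on an open interval containing a; only one square root is admissible at times where a_1, a_2 do not both vanish; ''the exact solution'' means every solution with r>0 and 0<(n-1)θ<π/2; the limit z→0 is for c_1>0 (and K_0≠0 for θ). *)

(* Defs.v *)
From Stdlib Require Import Reals.
From Coquelicot Require Import Coquelicot.
Open Scope R_scope.

Definition in_interval (alpha beta : Rbar) (t : R) : Prop :=
  Rbar_lt alpha t /\ Rbar_lt t beta.

(* Pointwise form of the system at time t.  The first three clauses are the
   domain on which the polar vector field is meaningful for a real exponent n:
   r is a positive radius, and neither the quotients by sin[(n-1)theta] and
   tan[(n-1)theta] nor tan[(n-1)theta] itself is degenerate. *)
Definition deformed_bernoulli_at (n z : R) (a1 a2 r theta : R -> R) (t : R)
  : Prop :=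
  let phi := (n - 1) * theta t in
  let E := exp (z * Rpower (r t) (n - 1) / sin phi) in
  0 < r t /\ sin phi <> 0 /\ cos phi <> 0 /\
  is_derive r t
    (a1 t * (r t * cos phi ^ 2 * E
             + sin phi ^ 3 / (z * Rpower (r t) (n - 2)) * (E - 1))
     + a2 t * Rpower (r t) n * cos phi) /\
  is_derive theta t
    (a1 t * sin phi ^ 2 *
       (E / tan phi - cos phi / (z * Rpower (r t) (n - 1)) * (E - 1))
     + a2 t * Rpower (r t) (n - 1) * sin phi).

Definition gamma (n : R) (a1 : R -> R) (a t : R) : R :=
  (n - 1) * RInt a1 a t.

Definition Lfun (n z c1 : R) (a1 : R -> R) (a t : R) : R :=
  ln (1 - z * c1 * exp (gamma n a1 a t)) / z.

Definition sigma (n z c1 : R) (a1 : R -> R) (a t : R) : R :=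
  RInt (fun u => (n - 1) * a1 u / (1 - z * c1 * exp (gamma n a1 a u))) a t.

Definition Kfun (n z c1 c2 : R) (a1 a2 : R -> R) (a t : R) : R :=
  c2 + RInt (fun u => exp (sigma n z c1 a1 a u) * a2 u) a t.

Definition r_sol (n z c1 c2 : R) (a1 a2 : R -> R) (a t : R) : R :=
  let L := Lfun n z c1 a1 a t in
  let K := Kfun n z c1 c2 a1 a2 a t in
  Rpower (- L) (1 / (n - 1)) *
  Rpower (1 + (n - 1) ^ 2 * L ^ 2 * exp (- 2 * sigma n z c1 a1 a t) * K ^ 2)
         (- 1 / (2 * (n - 1))).

Definition theta_sol (n z c1 c2 : R) (a1 a2 : R -> R) (a t : R) : R :=
  1 / (n - 1) *
  atan (exp (sigma n z c1 a1 a t) /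
        ((n - 1) * Lfun n z c1 a1 a t * Kfun n z c1 c2 a1 a2 a t)).

(* The closed-form expressions are meaningful at t: the integrand of sigma has
   no pole between a and t and the logarithm in L is real (a zero of
   1 - z c1 e^gamma between a and t makes the integral defining sigma diverge),
   the base -L of the real power is positive, and the argument of the
   arctangent has nonzero denominator. *)
Definition sol_defined (n z c1 c2 : R) (a1 a2 : R -> R) (a t : R) : Prop :=
  (forall s, Rmin a t <= s <= Rmax a t ->
     0 < 1 - z * c1 * exp (gamma n a1 a s)) /\
  0 < - Lfun n z c1 a1 a t /\
  Kfun n z c1 c2 a1 a2 a t <> 0.

Definition admissible_root (n z c1 c2 : R) (a1 a2 : R -> R) (a t : R) : Prop :=
  let L := Lfun n z c1 a1 a t in
  let K := Kfun n z c1 c2 a1 a2 a t in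
  sqrt ((n - 1) ^ 2 * L ^ 2 * K ^ 2) = (n - 1) * L * K.

Definition K0fun (n c2 : R) (a1 a2 : R -> R) (a t : R) : R :=
  c2 + RInt (fun s => exp (gamma n a1 a s) * a2 s) a t.

Definition r_undeformed (n c1 c2 : R) (a1 a2 : R -> R) (a t : R) : R :=
  Rpower (c1 * exp (gamma n a1 a t) /
          sqrt (1 + (n - 1) ^ 2 * c1 ^ 2 * K0fun n c2 a1 a2 a t ^ 2))
         (1 / (n - 1)).

Definition theta_undeformed (n c1 c2 : R) (a1 a2 : R -> R) (a t : R) : R :=
  - (1 / (n - 1)) * atan (1 / ((n - 1) * c1 * K0fun n c2 a1 a2 a t)).

(* Main.v *)
Require Import Defs.
From Stdlib Require Import Reals Lra.
From Coquelicot Require Import Coquelicot.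
Open Scope R_scope.

(* With m = n - 1, the functions x = r^m / sin(m theta) and
   y = - cos(m theta) / (m r^m) turn the system into
   x' = m a1 (e^(zx) - 1) / z,  y' = - m a1 e^(zx) y + a2.
   The quantity (1 - e^(-zx)) / z satisfies the linear equation w' = m a1 w, so
   e^(-zx) = 1 - z c1 e^gamma, and then y e^sigma is a primitive of
   e^sigma a2: thus x = -L and y = e^(-sigma) K.  Going back to polar
   coordinates, tan(m theta) = -1/(m x y), and x > 0 forces sin(m theta) > 0,
   which decides the square root.  For the limit z -> 0 one uses
   e^sigma = e^gamma (1 - z c1) / (1 - z c1 e^gamma), which converges uniformly
   between a and t. *)

(** * Polar and Cartesian forms of the system *)

Definition cart_x (m r theta : R) : R := Rpower r m / sin (m * theta).

Definition cart_y (m r theta : R) : R := cos (m * theta) / (- m * Rpower r m).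

(** Since [m x y] is minus the cotangent of the angle [m theta], the second factor is a power of
    [1 / sin^2]. It undoes the division by the sine in [cart_x]. *)
Definition polar_r (m x y : R) : R :=
  Rpower x (1 / m) * Rpower (1 + m ^ 2 * x ^ 2 * y ^ 2) (- 1 / (2 * m)).

(** The branch of [atan] keeps [m theta] in [(-PI/2, PI/2)], so the cosine is always positive and
    only the sign of the sine depends on [m x y]. *)
Definition polar_theta (m x y : R) : R := 1 / m * atan (- (1 / (m * x * y))).

Lemma Rpower_pos (x p : R) : 0 < Rpower x p.
Proof. apply exp_pos. Qed.

(* Eta-expanded, as [auto_derive] leaves it. *)
Lemma Derive_eta (f : R -> R) (t l : R) :
  is_derive f t l -> Derive (fun u => f u) t = l.
Proof. exact (is_derive_unique f t l). Qed.

Lemma one_plus_sq_pos (w : R) : 0 < 1 + w ^ 2.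
Proof. generalize (pow2_ge_0 w); lra. Qed.

(* [e] is the sign of the sine. *)
Lemma polar_coords (m x y e : R) :
  m <> 0 -> 0 < x -> e * e = 1 -> 0 < - e * (m * x * y) ->
  let s := sqrt (1 + (m * x * y) ^ 2) in
  0 < s /\
  Rpower (polar_r m x y) m = x / s /\
  sin (m * polar_theta m x y) = e / s /\
  cos (m * polar_theta m x y) = - e * (m * x * y) / s.
Proof.
intros hm hx he hw s.
assert (hD := one_plus_sq_pos (m * x * y)).
assert (hs : 0 < s) by (apply sqrt_lt_R0; exact hD).
assert (hs2 : s * s = 1 + (m * x * y) ^ 2) by (apply sqrt_sqrt; lra).
assert (hw0 : m * x * y <> 0) by (intro h; rewrite h in hw; lra).
split; [exact hs|split].
- unfold polar_r.
  rewrite <- Rpower_mult_distr by apply Rpower_pos.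
  rewrite !Rpower_mult.
  replace (1 / m * m) with 1 by (field; exact hm).
  rewrite (Rpower_1 x hx).
  replace (-1 / (2 * m) * m) with (- / 2) by (field; exact hm).
  rewrite Rpower_Ropp.
  replace (1 + m ^ 2 * x ^ 2 * y ^ 2) with (1 + (m * x * y) ^ 2) by ring.
  rewrite Rpower_sqrt by exact hD.
  reflexivity.
- replace (m * polar_theta m x y) with (atan (- (1 / (m * x * y))))
    by (unfold polar_theta; field; repeat split; try assumption;
        intro h; apply hw0; rewrite h; ring).
  set (w := m * x * y) in *.
  (* The positive number [- e * w] is the absolute value of [w], because [e] is 1 or -1. *)
  assert (hq : sqrt (1 + (- (1 / w))²) = s / (- e * w)).
  { apply sqrt_lem_1.
    - generalize (Rle_0_sqr (- (1 / w))); lra.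
    - apply Rlt_le, Rdiv_lt_0_compat; assumption.
    - replace (s / (- e * w) * (s / (- e * w)))
        with (s * s / (e * e * w * w)) by (field; split; [exact hw0|intro h; rewrite h in he; lra]).
      rewrite hs2, he; unfold Rsqr; field; exact hw0. }
  assert (he0 : e <> 0) by (intro h; rewrite h in he; lra).
  rewrite sin_atan, cos_atan, hq.
  split; field; repeat split; try lra; exact hw0.
Qed.

(** * From the polar system to the transformed system *)

Lemma is_derive_cart_x (m dr dth t : R) (r theta : R -> R) :
  0 < r t -> sin (m * theta t) <> 0 ->
  is_derive r t dr -> is_derive theta t dth ->
  is_derive (fun u => cart_x m (r u) (theta u)) t
    (m * Rpower (r t) m / sin (m * theta t) *
     (dr / r t - cos (m * theta t) / sin (m * theta t) * dth)).
Proof.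
intros hr hs hdr hdth.
unfold cart_x, Rpower; auto_derive.
- repeat split; try assumption; [exists dr|exists dth]; assumption.
- rewrite (Derive_eta _ _ _ hdr), (Derive_eta _ _ _ hdth).
  field; split; [|lra]; exact hs.
Qed.

Lemma is_derive_cart_y (m dr dth t : R) (r theta : R -> R) :
  m <> 0 -> 0 < r t ->
  is_derive r t dr -> is_derive theta t dth ->
  is_derive (fun u => cart_y m (r u) (theta u)) t
    ((sin (m * theta t) * dth + cos (m * theta t) * dr / r t)
     / Rpower (r t) m).
Proof.
intros hm hr hdr hdth.
assert (hp := Rpower_pos (r t) m).
unfold cart_y, Rpower in *; auto_derive.
- repeat split; try assumption; try (exists dr; assumption);
    try (exists dth; assumption).
  apply Rmult_integral_contrapositive_currified; lra.
- rewrite (Derive_eta _ _ _ hdr), (Derive_eta _ _ _ hdth).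
  field; repeat split; lra.
Qed.

(** Together with [Rpower_succ], this leaves [Rpower r (n - 1)] as the only power of [r] in the
    system, a single atom for [field]. *)
Lemma Rpower_pred (n r : R) : 0 < r -> Rpower r (n - 2) = Rpower r (n - 1) / r.
Proof.
intro hr; replace (n - 2) with (n - 1 + - (1)) by ring.
rewrite Rpower_plus, Rpower_Ropp, Rpower_1 by exact hr; reflexivity.
Qed.

Lemma Rpower_succ (n r : R) : 0 < r -> Rpower r n = Rpower r (n - 1) * r.
Proof.
intro hr; replace n with (n - 1 + 1) at 1 by ring.
rewrite Rpower_plus, Rpower_1 by exact hr; reflexivity.
Qed.

Lemma cartesian_system (n z : R) (a1 a2 r theta : R -> R) (t : R) :
  n <> 1 -> z <> 0 -> deformed_bernoulli_at n z a1 a2 r theta t ->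
  let X u := cart_x (n - 1) (r u) (theta u) in
  let Y u := cart_y (n - 1) (r u) (theta u) in
  is_derive X t ((n - 1) * a1 t * ((exp (z * X t) - 1) / z)) /\
  is_derive Y t (- (n - 1) * a1 t * exp (z * X t) * Y t + a2 t).
Proof.
intros hn hz [hr [hs [hc [hdr hdth]]]] X Y.
cbv zeta in hs, hc, hdr, hdth.
rewrite (Rpower_pred n _ hr), (Rpower_succ n _ hr) in hdr.
assert (hm : n - 1 <> 0) by lra.
assert (hp := Rpower_pos (r t) (n - 1)).
assert (hE : exp (z * X t) = exp (z * Rpower (r t) (n - 1) / sin ((n - 1) * theta t)))
  by (f_equal; unfold X, cart_x; field; exact hs).
rewrite hE.
assert (hx := is_derive_cart_x (n - 1) _ _ t r theta hr hs hdr hdth).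
assert (hy := is_derive_cart_y (n - 1) _ _ t r theta hm hr hdr hdth).
unfold tan in hx, hy.
assert (h1 := sin2_cos2 ((n - 1) * theta t)).
unfold X, Y, cart_y; unfold Rsqr in h1.
set (E := exp _) in *; set (p := Rpower _ _) in *.
set (S := sin _) in *; set (C := cos _) in *.
split.
- evar_last; [exact hx|].
  (* Keeping [S * S + C * C] as an explicit factor makes the first equality a rational identity; the
     Pythagorean relation enters only through [h1]. *)
  transitivity ((n - 1) * a1 t * ((E - 1) / z) * (S * S + C * C)).
  + field; repeat split; lra.
  + rewrite h1; ring.
- evar_last; [exact hy|].
  transitivity (a1 t * C / p * (S * S + C * C) * E + a2 t * (S * S + C * C)).
  + field; repeat split; lra.
  + rewrite h1; field; repeat split; lra.
Qed.

(** * From the transformed system back to the polar system *)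

Lemma is_derive_polar_r (m t dx dy : R) (x y : R -> R) :
  m <> 0 -> 0 < x t -> is_derive x t dx -> is_derive y t dy ->
  is_derive (fun u => polar_r m (x u) (y u)) t
    (polar_r m (x t) (y t) *
     (dx / (m * x t) - m * x t * y t * (dx * y t + x t * dy)
                       / (1 + (m * x t * y t) ^ 2))).
Proof.
intros hm hx hdx hdy.
assert (hD := one_plus_sq_pos (m * x t * y t)).
unfold polar_r, Rpower; auto_derive.
- repeat split; try assumption; try (exists dx; assumption);
    try (exists dy; assumption).
  replace (_ + _) with (1 + (m * x t * y t) ^ 2) by ring; exact hD.
- rewrite (Derive_eta _ _ _ hdx), (Derive_eta _ _ _ hdy).
  change (m * (m * 1)) with (m ^ 2).
  change (x t * (x t * 1)) with (x t ^ 2); change (y t * (y t * 1)) with (y t ^ 2).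
  set (A := exp (1 / m * _)); set (B := exp (_ * _)).
  field; repeat split; lra.
Qed.

Lemma is_derive_polar_theta (m t dx dy : R) (x y : R -> R) :
  m <> 0 -> x t <> 0 -> y t <> 0 -> is_derive x t dx -> is_derive y t dy ->
  is_derive (fun u => polar_theta m (x u) (y u)) t
    ((dx * y t + x t * dy) / (1 + (m * x t * y t) ^ 2)).
Proof.
intros hm hx hy hdx hdy.
assert (hD := one_plus_sq_pos (m * x t * y t)).
unfold polar_theta; auto_derive.
- repeat split; try assumption; try (exists dx; assumption);
    try (exists dy; assumption).
  repeat apply Rmult_integral_contrapositive_currified; assumption.
- rewrite (Derive_eta _ _ _ hdx), (Derive_eta _ _ _ hdy).
  field; repeat split; try assumption; lra.
Qed.

(** Converse of [cartesian_system]. The sign condition on [(n - 1) x y] selects [e = 1] in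
    [polar_coords], that is, a positive sine, in agreement with [x > 0]. *)
Lemma polar_system (n z t : R) (a1 a2 x y : R -> R) :
  n <> 1 -> z <> 0 -> 0 < x t -> 0 < - ((n - 1) * x t * y t) ->
  is_derive x t ((n - 1) * a1 t * ((exp (z * x t) - 1) / z)) ->
  is_derive y t (- (n - 1) * a1 t * exp (z * x t) * y t + a2 t) ->
  deformed_bernoulli_at n z a1 a2
    (fun u => polar_r (n - 1) (x u) (y u))
    (fun u => polar_theta (n - 1) (x u) (y u)) t.
Proof.
intros hn hz hx hw hdx hdy.
assert (hm : n - 1 <> 0) by lra.
assert (hy : y t <> 0) by (intro h; rewrite h in hw; lra).
destruct (polar_coords (n - 1) (x t) (y t) 1 hm hx ltac:(ring) ltac:(lra))
  as [hs [hp [hS hC]]].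
assert (hD := one_plus_sq_pos ((n - 1) * x t * y t)).
assert (hs2 := sqrt_sqrt _ (Rlt_le _ _ hD)).
assert (hr : 0 < polar_r (n - 1) (x t) (y t))
  by (apply Rmult_lt_0_compat; apply Rpower_pos).
unfold deformed_bernoulli_at; cbv zeta.
rewrite (Rpower_pred n _ hr), (Rpower_succ n _ hr), hS, hC, hp.
unfold tan; rewrite hS, hC.
assert (hdr := is_derive_polar_r (n - 1) t _ _ x y hm hx hdx hdy).
assert (hdth := is_derive_polar_theta (n - 1) t _ _ x y hm
  (Rgt_not_eq _ _ hx) hy hdx hdy).
(* Writing [1 + ((n - 1) x y)^2] as [s * s] leaves [s] as an atom, so that [field] meets no square
   root. *)
rewrite <- hs2 in hdr, hdth.
set (s := sqrt _) in *.
replace (z * (x t / s) / (1 / s)) with (z * x t) by (field; lra).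
set (E := exp (z * x t)) in *.
assert (hs2' : (n - 1) * x t * y t * ((n - 1) * x t * y t) = s * s - 1) by (rewrite hs2; ring).
split; [exact hr|split].
{ apply Rgt_not_eq, Rdiv_lt_0_compat; lra. }
split.
{ apply Rgt_not_eq, Rdiv_lt_0_compat; lra. }
split.
- evar_last; [exact hdr|].
  set (r := polar_r _ _ _) in *.
  (* With [w = (n - 1) x y], the factor [sin^2 = 1 / s^2] is written as [(s^2 - w^2) / s^2]; the
     relation [w^2 = s^2 - 1] is then used only by the rewrite with [hs2']. *)
  transitivity (r * a1 t * ((- (1) * ((n - 1) * x t * y t) / s) ^ 2 * E
      + (s * s - (n - 1) * x t * y t * ((n - 1) * x t * y t)) / (s * s)
        * ((E - 1) / (z * x t)))
    + a2 t * (x t / s * r) * (- (1) * ((n - 1) * x t * y t) / s)).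
  + field; repeat split; lra.
  + rewrite hs2'; field; repeat split; lra.
- evar_last; [exact hdth|].
  field; repeat split; lra.
Qed.

(** * Primitives based at [a] and the closed form *)

(* The domains on which primitives based at [a] can be differentiated. *)
Definition star_open (a : R) (G : R -> Prop) : Prop :=
  forall t, G t ->
    (forall s, Rmin a t <= s <= Rmax a t -> G s) /\ locally t G.

Lemma in_interval_open (alpha beta : Rbar) (t : R) :
  in_interval alpha beta t -> locally t (in_interval alpha beta).
Proof.
intros [h1 h2]; apply (locally_interval _ t alpha beta h1 h2).
intros y; split; assumption.
Qed.

Lemma in_interval_between (alpha beta : Rbar) (a t s : R) :
  in_interval alpha beta a -> in_interval alpha beta t ->
  Rmin a t <= s <= Rmax a t -> in_interval alpha beta s.
Proof.
intros [ha1 ha2] [ht1 ht2] [hs1 hs2].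
unfold in_interval.
revert hs1 hs2; unfold Rmin, Rmax.
destruct alpha, beta; simpl in *; destruct (Rle_dec a t); intros; split; try easy; lra.
Qed.

Lemma star_open_interval (alpha beta : Rbar) (a : R) :
  in_interval alpha beta a -> star_open a (in_interval alpha beta).
Proof.
intros ha t ht; split.
- intros s; apply in_interval_between; assumption.
- apply in_interval_open; exact ht.
Qed.

Section FTC.
Variables (a : R) (G : R -> Prop).
Hypothesis hG : star_open a G.

Lemma star_ex_RInt (f : R -> R) (t : R) :
  (forall s, G s -> continuous f s) -> G t -> ex_RInt f a t.
Proof.
intros hf ht; apply (ex_RInt_continuous f).
intros s hs; apply hf, (proj1 (hG t ht)), hs.
Qed.

Lemma star_is_derive_RInt (f : R -> R) (t : R) :
  (forall s, G s -> continuous f s) -> G t -> is_derive (RInt f a) t (f t).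
Proof.
intros hf ht.
apply (is_derive_RInt f (RInt f a) a t); [|apply hf; exact ht].
apply (filter_imp G); [|apply hG; exact ht].
intros s hs; apply (RInt_correct f), star_ex_RInt; assumption.
Qed.

(** Tool for conserved quantities: the segment from [a] to [t] stays in [G], so the mean value
    theorem applies; the cases are its two orientations and [t = a]. *)
Lemma star_derive_zero (f : R -> R) (t : R) :
  (forall s, G s -> is_derive f s 0) -> G t -> f t = f a.
Proof.
intros hf ht.
assert (h : forall s, Rmin a t <= s <= Rmax a t -> is_derive f s 0)
  by (intros s hs; apply hf, (proj1 (hG t ht)), hs).
destruct (Rtotal_order a t) as [hat|[hat|hat]].
- symmetry; apply (eq_is_derive f a t); [|exact hat].
  intros s hs; apply h; rewrite Rmin_left, Rmax_right; lra.
- rewrite hat; reflexivity.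
- apply (eq_is_derive f t a); [|exact hat].
  intros s hs; apply h; rewrite Rmin_right, Rmax_left; lra.
Qed.

End FTC.

Lemma Rmin_Rmax_trans (a t s u : R) :
  Rmin a t <= s <= Rmax a t -> Rmin a s <= u <= Rmax a s ->
  Rmin a t <= u <= Rmax a t.
Proof.
unfold Rmin, Rmax; destruct (Rle_dec a t), (Rle_dec a s); lra.
Qed.

(** * Derivatives of the functions in the closed form, and why it solves the system *)

Section Primitives.
Variables (n z c1 c2 : R) (a1 a2 : R -> R) (alpha beta : Rbar) (a : R).
Hypothesis (ha : in_interval alpha beta a).
Hypothesis ha1 : forall t, in_interval alpha beta t -> continuous a1 t.
Hypothesis ha2 : forall t, in_interval alpha beta t -> continuous a2 t.

Lemma is_derive_gamma (t : R) :
  in_interval alpha beta t -> is_derive (gamma n a1 a) t ((n - 1) * a1 t).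
Proof.
intro ht; unfold gamma.
apply (is_derive_scal (RInt a1 a) t (n - 1) (a1 t)).
apply (star_is_derive_RInt a _ (star_open_interval _ _ _ ha)); assumption.
Qed.

(* The factor [1 - z c1 e^gamma] is [e^(-zx)] along the solution. *)
Definition decay (t : R) : R := 1 - z * c1 * exp (gamma n a1 a t).

Lemma is_derive_decay (t : R) :
  in_interval alpha beta t ->
  is_derive decay t (- (z * c1 * exp (gamma n a1 a t)) * ((n - 1) * a1 t)).
Proof.
intro ht; assert (h := is_derive_gamma t ht).
unfold decay; auto_derive.
- repeat split; exists ((n - 1) * a1 t); exact h.
-  rewrite (Derive_eta _ _ _ h); ring.
Qed.

Lemma continuous_decay (t : R) :
  in_interval alpha beta t -> continuous decay t.
Proof.
intro ht; apply (ex_derive_continuous decay); eexists; apply is_derive_decay, ht.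
Qed.

(** Positivity is required on the whole segment from [a], because the integral defining [sigma] runs
    through it. *)
Definition regular (t : R) : Prop :=
  in_interval alpha beta t /\
  forall s, Rmin a t <= s <= Rmax a t -> 0 < decay s.

Lemma regular_decay (t : R) : regular t -> 0 < decay t.
Proof. intros [_ h]; apply h; split; [apply Rmin_r|apply Rmax_r]. Qed.

(** For [s] near [t], a point between [a] and [s] lies either between [a] and [t] or no farther from
    [t] than [s] does; near [t], continuity keeps [decay] positive. *)
Lemma star_open_regular : star_open a regular.
Proof.
intros t [ht hd]; split.
- intros s hs; split; [exact (in_interval_between _ _ a t s ha ht hs)|].
  intros u hu; apply hd; eapply Rmin_Rmax_trans; eassumption.
- assert (hdt := regular_decay t (conj ht hd)).
  assert (hloc : locally t (fun s => in_interval alpha beta s /\ 0 < decay s)).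
  { apply filter_and; [apply in_interval_open; exact ht|].
    apply (continuous_decay t ht (fun y => 0 < y)).
    exact (open_gt 0 _ hdt). }
  destruct hloc as [eps heps]; exists eps; intros s hs; split; [apply heps, hs|].
  intros u hu.
  destruct (Rle_dec (Rmin a t) u) as [h1|h1];
    [destruct (Rle_dec u (Rmax a t)) as [h2|h2]; [apply hd; split; assumption|]|];
    apply heps; apply Rabs_def2 in hs; apply Rabs_def1;
    unfold minus, plus, opp in *; simpl in *;
    revert h1 hu; try revert h2; unfold Rmin, Rmax;
    destruct (Rle_dec a t), (Rle_dec a s); lra.
Qed.

Lemma is_derive_Lfun (t : R) :
  z <> 0 -> regular t ->
  is_derive (Lfun n z c1 a1 a) t
    (- (n - 1) * a1 t * ((/ decay t - 1) / z)).
Proof.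
intros hz ht.
assert (hd := regular_decay t ht).
assert (h := is_derive_decay t (proj1 ht)).
apply (is_derive_ext (fun u => ln (decay u) / z)); [reflexivity|].
auto_derive.
- repeat split; [eexists; exact h|exact hd].
- rewrite (Derive_eta _ _ _ h); revert hd; unfold decay; intro hd.
  field; split; lra.
Qed.

Lemma continuous_sigma_integrand (t : R) :
  regular t ->
  continuous (fun u => (n - 1) * a1 u / (1 - z * c1 * exp (gamma n a1 a u))) t.
Proof.
intro ht.
apply (continuous_mult (fun u => (n - 1) * a1 u) (fun u => / decay u)).
- apply (continuous_mult (fun _ => n - 1) a1); [apply continuous_const|].
  apply ha1, ht.
- apply (continuous_comp decay Rinv); [apply continuous_decay, ht|].
  apply continuous_Rinv, Rgt_not_eq, regular_decay, ht.
Qed.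

Lemma is_derive_sigma (t : R) :
  regular t -> is_derive (Defs.sigma n z c1 a1 a) t ((n - 1) * a1 t / decay t).
Proof.
intro ht; unfold sigma.
apply (star_is_derive_RInt a regular star_open_regular
  (fun u => (n - 1) * a1 u / (1 - z * c1 * exp (gamma n a1 a u)))); [|exact ht].
apply continuous_sigma_integrand.
Qed.

Lemma continuous_Kfun_integrand (t : R) :
  regular t -> continuous (fun u => exp (Defs.sigma n z c1 a1 a u) * a2 u) t.
Proof.
intro ht.
apply (continuous_mult (fun u => exp (Defs.sigma n z c1 a1 a u)) a2); [|apply ha2, ht].
apply (continuous_comp (Defs.sigma n z c1 a1 a) exp).
- apply (ex_derive_continuous (Defs.sigma n z c1 a1 a)); eexists; apply is_derive_sigma, ht.
- apply (ex_derive_continuous exp); eexists; apply is_derive_exp.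
Qed.

Lemma is_derive_Kfun (t : R) :
  regular t ->
  is_derive (Kfun n z c1 c2 a1 a2 a) t (exp (Defs.sigma n z c1 a1 a t) * a2 t).
Proof.
intro ht; unfold Kfun.
evar_last.
- apply (is_derive_plus (fun _ => c2)); [apply is_derive_const|].
  apply (star_is_derive_RInt a regular star_open_regular
    (fun u => exp (Defs.sigma n z c1 a1 a u) * a2 u)); [|exact ht].
  apply continuous_Kfun_integrand.
- apply Rplus_0_l.
Qed.

(* [x = -L] and [y = e^(-sigma) K] solve the transformed system. *)
Definition xsol (t : R) : R := - Lfun n z c1 a1 a t.
Definition ysol (t : R) : R :=
  exp (- Defs.sigma n z c1 a1 a t) * Kfun n z c1 c2 a1 a2 a t.

(** Consequently the integrand of [sigma] is [(n - 1) a1 e^(zx)], which makes [e^sigma] an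
    integrating factor of the linear equation for [y]. *)
Lemma exp_xsol (t : R) : z <> 0 -> regular t -> exp (z * xsol t) = / decay t.
Proof.
intros hz ht; unfold xsol, Lfun.
replace (z * _) with (- ln (decay t)) by (unfold decay; field; exact hz).
rewrite exp_Ropp, exp_ln; [reflexivity|apply regular_decay, ht].
Qed.

Lemma is_derive_xsol (t : R) :
  z <> 0 -> regular t ->
  is_derive xsol t ((n - 1) * a1 t * ((exp (z * xsol t) - 1) / z)).
Proof.
intros hz ht; rewrite exp_xsol by assumption.
evar_last; [exact (is_derive_opp _ _ _ (is_derive_Lfun t hz ht))|].
unfold opp; simpl; ring.
Qed.

Lemma is_derive_ysol (t : R) :
  z <> 0 -> regular t ->
  is_derive ysol t (- (n - 1) * a1 t * exp (z * xsol t) * ysol t + a2 t).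
Proof.
intros hz ht; rewrite exp_xsol by assumption.
assert (hs := is_derive_sigma t ht); assert (hK := is_derive_Kfun t ht).
unfold ysol; auto_derive.
- repeat split; [eexists; exact hs|eexists; exact hK].
- rewrite (Derive_eta _ _ _ hs), (Derive_eta _ _ _ hK).
  rewrite exp_Ropp; field; split; apply Rgt_not_eq;
    [apply exp_pos|apply regular_decay, ht].
Qed.

Lemma r_sol_polar (t : R) :
  r_sol n z c1 c2 a1 a2 a t = polar_r (n - 1) (xsol t) (ysol t).
Proof.
unfold r_sol, polar_r, xsol, ysol; cbv zeta.
do 2 f_equal.
replace (-2 * Defs.sigma n z c1 a1 a t)
  with (- Defs.sigma n z c1 a1 a t + - Defs.sigma n z c1 a1 a t) by ring.
rewrite exp_plus; ring.
Qed.

Lemma theta_sol_polar (t : R) :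
  theta_sol n z c1 c2 a1 a2 a t = polar_theta (n - 1) (xsol t) (ysol t).
Proof.
unfold theta_sol, polar_theta, xsol, ysol; cbv zeta.
do 2 f_equal; rewrite exp_Ropp.
set (e := exp _); assert (he : e <> 0) by (apply Rgt_not_eq, exp_pos).
set (L := Lfun _ _ _ _ _ _); set (K := Kfun _ _ _ _ _ _ _ _).
(* The laws of [Rinv] used next hold at zero too, so the equality covers times where [L] or [K]
   vanishes. It is needed at every time to transport derivatives along it. *)
replace ((n - 1) * - L * (/ e * K)) with (- ((n - 1) * L * K * / e)) by ring.
unfold Rdiv; rewrite Rinv_opp, (Rinv_mult _ (/ e)), Rinv_inv; ring.
Qed.

(** * The choice of square root as a sign condition *)

Lemma xy_LK (t : R) :
  - ((n - 1) * xsol t * ysol t) =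
  (n - 1) * Lfun n z c1 a1 a t * Kfun n z c1 c2 a1 a2 a t
  * exp (- Defs.sigma n z c1 a1 a t).
Proof. unfold xsol, ysol; ring. Qed.

(** The square root is the absolute value of [(n - 1) L K], so admissibility says that this product
    is nonnegative; it is nonzero, and [- (n - 1) x y] differs from it by the positive factor
    [e^(-sigma)]. *)
Lemma admissible_root_sign (t : R) :
  n <> 1 -> sol_defined n z c1 c2 a1 a2 a t ->
  admissible_root n z c1 c2 a1 a2 a t <-> 0 < - ((n - 1) * xsol t * ysol t).
Proof.
intros hn [_ [hL hK]]; rewrite xy_LK.
unfold admissible_root; cbv zeta.
revert hL hK; set (L := Lfun _ _ _ _ _ _); set (K := Kfun _ _ _ _ _ _ _ _).
clearbody L K; intros hL hK.
assert (he := exp_pos (- Defs.sigma n z c1 a1 a t)).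
replace ((n - 1) ^ 2 * L ^ 2 * K ^ 2) with (Rsqr ((n - 1) * L * K))
  by (unfold Rsqr; ring).
rewrite sqrt_Rsqr_abs.
assert (h0 : (n - 1) * L * K <> 0)
  by (repeat apply Rmult_integral_contrapositive_currified; [apply Rminus_eq_contra, hn|apply Rlt_not_eq; lra|exact hK]).
split; intro h.
- apply Rmult_lt_0_compat; [|exact he].
  rewrite <- h; apply Rabs_pos_lt, h0.
- apply Rabs_pos_eq, Rlt_le, (Rmult_lt_reg_r _ _ _ he).
  rewrite Rmult_0_l; exact h.
Qed.

Lemma sol_defined_regular (t : R) :
  in_interval alpha beta t -> sol_defined n z c1 c2 a1 a2 a t -> regular t.
Proof. intros ht [h _]; split; assumption. Qed.

Lemma closed_form_solves (t : R) :
  n <> 1 -> z <> 0 -> in_interval alpha beta t ->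
  sol_defined n z c1 c2 a1 a2 a t -> admissible_root n z c1 c2 a1 a2 a t ->
  deformed_bernoulli_at n z a1 a2
    (r_sol n z c1 c2 a1 a2 a) (theta_sol n z c1 c2 a1 a2 a) t.
Proof.
intros hn hz ht hd hadm.
assert (hreg := sol_defined_regular t ht hd).
destruct (polar_system n z t a1 a2 xsol ysol hn hz (proj1 (proj2 hd))
  (proj1 (admissible_root_sign t hn hd) hadm)
  (is_derive_xsol t hz hreg) (is_derive_ysol t hz hreg))
  as [hr [hs [hc [hdr hdth]]]].
unfold deformed_bernoulli_at; cbv zeta.
rewrite r_sol_polar, theta_sol_polar.
split; [exact hr|split; [exact hs|split; [exact hc|split]]].
- eapply is_derive_ext; [|exact hdr]; intro u; symmetry; apply r_sol_polar.
- eapply is_derive_ext; [|exact hdth]; intro u; symmetry; apply theta_sol_polar.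
Qed.

(* With the other square root, [cart_x] and [cart_y] of the closed form are
   [-x] and [-y]; if these also solved the transformed system, comparing with
   the equations of [x] and [y] would give [a1 (e^(zx) + e^(-zx) - 2) = 0] and
   then [a2 = 0]. *)
Lemma solution_admissible (t : R) :
  n <> 1 -> z <> 0 -> in_interval alpha beta t ->
  sol_defined n z c1 c2 a1 a2 a t -> a1 t <> 0 \/ a2 t <> 0 ->
  deformed_bernoulli_at n z a1 a2
    (r_sol n z c1 c2 a1 a2 a) (theta_sol n z c1 c2 a1 a2 a) t ->
  admissible_root n z c1 c2 a1 a2 a t.
Proof.
intros hn hz ht hd hne hsys.
assert (hreg := sol_defined_regular t ht hd).
assert (hm : n - 1 <> 0) by lra.
apply (admissible_root_sign t hn hd).
destruct (Rlt_dec 0 (- ((n - 1) * xsol t * ysol t))) as [h|h]; [exact h|exfalso].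
assert (hx : 0 < xsol t) by apply hd.
assert (hdx := is_derive_xsol t hz hreg).
assert (hdy := is_derive_ysol t hz hreg).
assert (hy : ysol t <> 0)
  by (apply Rmult_integral_contrapositive_currified;
      [apply Rgt_not_eq, exp_pos|apply hd]).
assert (hw0 : (n - 1) * xsol t * ysol t <> 0).
{ apply Rmult_integral_contrapositive_currified; [|exact hy].
  apply Rmult_integral_contrapositive_currified; lra. }
assert (hw : 0 < (n - 1) * xsol t * ysol t).
{ destruct (Rtotal_order 0 ((n - 1) * xsol t * ysol t)) as [h1|[h1|h1]];
    [exact h1|symmetry in h1; contradiction|lra]. }
assert (hcx : continuous xsol t)
  by (apply (ex_derive_continuous xsol); eexists; exact hdx).
assert (hcy : continuous ysol t)
  by (apply (ex_derive_continuous ysol); eexists; exact hdy).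
assert (hcw : continuous (fun u => (n - 1) * xsol u * ysol u) t).
{ apply (continuous_mult (fun u => (n - 1) * xsol u) ysol); [|exact hcy].
  apply (continuous_mult (fun _ => n - 1) xsol); [apply continuous_const|exact hcx]. }
(* The equalities are needed on a neighbourhood of [t], since derivatives are going to be compared;
   the sign of [(n - 1) x y] persists there by continuity, and [polar_coords] applies with
   [e = -1]. *)
assert (hcart : locally t (fun u =>
  cart_x (n - 1) (r_sol n z c1 c2 a1 a2 a u) (theta_sol n z c1 c2 a1 a2 a u)
    = - xsol u /\
  cart_y (n - 1) (r_sol n z c1 c2 a1 a2 a u) (theta_sol n z c1 c2 a1 a2 a u)
    = - ysol u)).
{ apply (filter_imp (fun u => 0 < xsol u /\ 0 < (n - 1) * xsol u * ysol u)).
  - intros u [hxu hwu]; rewrite r_sol_polar, theta_sol_polar.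
    destruct (polar_coords (n - 1) (xsol u) (ysol u) (-1) hm hxu ltac:(ring) ltac:(lra))
      as [hs [hp [hS hC]]].
    unfold cart_x, cart_y; rewrite hS, hC, hp.
    split; field; repeat split; lra.
  - apply filter_and.
    + exact (hcx (fun v => 0 < v) (open_gt 0 _ hx)).
    + exact (hcw (fun v => 0 < v) (open_gt 0 _ hw)). }
destruct (cartesian_system n z a1 a2 _ _ t hn hz hsys) as [hX hY].
cbv beta in hX, hY.
destruct (locally_singleton _ _ hcart) as [eX eY].
rewrite eX in hX; rewrite eX, eY in hY.
assert (hX' : is_derive (fun u => - xsol u) t
  ((n - 1) * a1 t * ((exp (z * - xsol t) - 1) / z))).
{ eapply is_derive_ext_loc; [|exact hX].
  eapply filter_imp; [|exact hcart]; intros u hu; apply hu. }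
assert (hY' : is_derive (fun u => - ysol u) t
  (- (n - 1) * a1 t * exp (z * - xsol t) * - ysol t + a2 t)).
{ eapply is_derive_ext_loc; [|exact hY].
  eapply filter_imp; [|exact hcart]; intros u hu; apply hu. }
apply is_derive_unique in hX'; apply is_derive_unique in hY'.
rewrite Derive_opp, (is_derive_unique _ _ _ hdx) in hX'.
rewrite Derive_opp, (is_derive_unique _ _ _ hdy) in hY'.
replace (z * - xsol t) with (- (z * xsol t)) in * by ring.
rewrite exp_Ropp in hX', hY'.
assert (he := exp_pos (z * xsol t)).
assert (he1 : exp (z * xsol t) <> 1).
{ intro h1; rewrite <- exp_0 in h1; apply exp_inv, Rmult_integral in h1; lra. }
set (E := exp (z * xsol t)) in *.
assert (h1 : a1 t = 0).
(* The two values found for the derivative of [- xsol] differ by [a1 t] times this factor, because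
   [(1/E - 1) + (E - 1) = (E - 1)^2 / E]. It is nonzero since [z x <> 0] gives [E <> 1]. *)
{ apply (Rmult_eq_reg_l ((n - 1) * (E - 1) * (E - 1) / (E * z))).
  - rewrite Rmult_0_r.
    transitivity ((n - 1) * a1 t * ((/ E - 1) / z)
      - - ((n - 1) * a1 t * ((E - 1) / z))); [field; lra|rewrite hX'; ring].
  - apply Rmult_integral_contrapositive_currified;
      [|apply Rinv_neq_0_compat, Rmult_integral_contrapositive_currified; lra].
    repeat apply Rmult_integral_contrapositive_currified; lra. }
(* With [a1 t = 0], [hY'] reduces to [- a2 t = a2 t]. *)
rewrite h1 in *; destruct hne; lra.
Qed.

End Primitives.

(** * Uniqueness *)

(** On this quadrant [atan] inverts [tan], and the sine is positive, so the real powers of [cart_x]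
    are genuine. *)
Lemma polar_cart (m r theta : R) :
  m <> 0 -> 0 < r -> 0 < m * theta < PI / 2 ->
  polar_r m (cart_x m r theta) (cart_y m r theta) = r /\
  polar_theta m (cart_x m r theta) (cart_y m r theta) = theta.
Proof.
intros hm hr hth.
assert (hS : 0 < sin (m * theta)) by (apply sin_gt_0; lra).
assert (hC : 0 < cos (m * theta)) by (apply cos_gt_0; lra).
assert (hp := Rpower_pos r m).
assert (h1 := sin2_cos2 (m * theta)); unfold Rsqr in h1.
unfold polar_r, polar_theta, cart_x, cart_y; split.
(* Here [m x y = - cos / sin], and [1 + cot^2 = 1 / sin^2]. *)
- replace (1 + _) with (/ (sin (m * theta) * sin (m * theta))).
  2: { 
       transitivity ((sin (m * theta) * sin (m * theta) + cos (m * theta) * cos (m * theta))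
         / (sin (m * theta) * sin (m * theta))); [rewrite h1; field; lra|field; lra]. }
  (* Only the two outer powers are expanded; [Rpower r m] stays an atom until the logarithms of the
     sine have cancelled. *)
  unfold Rpower at 1 3; rewrite <- exp_plus.
  rewrite ln_div, ln_Rinv, ln_mult by (try apply Rmult_lt_0_compat; assumption).
  replace (_ + _) with (1 / m * ln (Rpower r m)) by (field; exact hm).
  rewrite <- (exp_ln r hr) at 2; f_equal.
  unfold Rpower; rewrite ln_exp; field; exact hm.
- replace (- _) with (tan (m * theta)) by (unfold tan; field; lra).
  rewrite atan_tan by lra; field; exact hm.
Qed.

Lemma gamma_base (n : R) (a1 : R -> R) (a : R) : gamma n a1 a a = 0.
Proof. unfold gamma; rewrite RInt_point; apply Rmult_0_r. Qed.

Lemma decay_base (n z c1 : R) (a1 : R -> R) (a : R) :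
  decay n z c1 a1 a a = 1 - z * c1.
Proof. unfold decay; rewrite gamma_base, exp_0; ring. Qed.

Section Uniqueness.
Variables (n z : R) (a1 a2 : R -> R) (alpha beta : Rbar) (a : R).
Variables r theta : R -> R.
Hypothesis hn : n <> 1.
Hypothesis hz : z <> 0.
Hypothesis ha : in_interval alpha beta a.
Hypothesis ha1 : forall t, in_interval alpha beta t -> continuous a1 t.
Hypothesis ha2 : forall t, in_interval alpha beta t -> continuous a2 t.
Hypothesis hsol : forall t, in_interval alpha beta t ->
  deformed_bernoulli_at n z a1 a2 r theta t /\ 0 < (n - 1) * theta t < PI / 2.

Let X (t : R) : R := cart_x (n - 1) (r t) (theta t).
Let Y (t : R) : R := cart_y (n - 1) (r t) (theta t).
(** The constants are read off at [a], where [gamma] and [sigma] vanish: there [e^(-zX) = 1 - z c1]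
    and [K = c2 = Y]. *)
Let c1 : R := (1 - exp (- (z * X a))) / z.
Let c2 : R := Y a.

(** The quantity [(1 - e^(-zX)) / z] satisfies a linear equation, so its product with [e^(-gamma)]
    is conserved and equals [c1]. *)
Lemma decay_of_solution (t : R) :
  in_interval alpha beta t -> decay n z c1 a1 a t = exp (- (z * X t)).
Proof.
intro ht.
assert (h : (1 - exp (- (z * X t))) / z * exp (- gamma n a1 a t)
          = (1 - exp (- (z * X a))) / z * exp (- gamma n a1 a a)).
{ apply (star_derive_zero a (in_interval alpha beta) (star_open_interval _ _ _ ha)
    (fun u => (1 - exp (- (z * X u))) / z * exp (- gamma n a1 a u))); [|exact ht].
  intros s hs.
  destruct (cartesian_system n z a1 a2 r theta s hn hz (proj1 (hsol s hs))) as [hX _].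
  assert (hg := is_derive_gamma n a1 alpha beta a ha ha1 s hs).
  fold X in hX; change (cart_x (n - 1) (r s) (theta s)) with (X s) in hX.
  auto_derive; [repeat split; eexists; eassumption|].
  rewrite (Derive_eta _ _ _ hX), (Derive_eta _ _ _ hg).
  rewrite !exp_Ropp; field; repeat split; try apply Rgt_not_eq, exp_pos; exact hz. }
rewrite gamma_base, Ropp_0, exp_0, Rmult_1_r in h; fold c1 in h.
unfold decay; rewrite <- h, (exp_Ropp (gamma _ _ _ _)).
field; split; [apply Rgt_not_eq, exp_pos|exact hz].
Qed.

(** Along a solution [decay] is an exponential, so [sigma] meets no pole anywhere on the
    interval. *)
Lemma solution_regular (t : R) :
  in_interval alpha beta t -> regular n z c1 a1 alpha beta a t.
Proof.
intro ht; split; [exact ht|].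
intros s hs; rewrite decay_of_solution; [apply exp_pos|].
exact (in_interval_between _ _ a t s ha ht hs).
Qed.

Lemma xsol_of_solution (t : R) :
  in_interval alpha beta t -> xsol n z c1 a1 a t = X t.
Proof.
intro ht; unfold xsol, Lfun; fold (decay n z c1 a1 a t).
rewrite (decay_of_solution t ht), ln_exp; field; exact hz.
Qed.

(** Both [e^sigma Y] and [K] have derivative [e^sigma a2], and they agree at [a]. *)
Lemma Kfun_of_solution (t : R) :
  in_interval alpha beta t ->
  Kfun n z c1 c2 a1 a2 a t = exp (Defs.sigma n z c1 a1 a t) * Y t.
Proof.
intro ht.
assert (h : exp (Defs.sigma n z c1 a1 a t) * Y t - Kfun n z c1 c2 a1 a2 a t
          = exp (Defs.sigma n z c1 a1 a a) * Y a - Kfun n z c1 c2 a1 a2 a a).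
{ apply (star_derive_zero a (in_interval alpha beta) (star_open_interval _ _ _ ha)
    (fun u => exp (Defs.sigma n z c1 a1 a u) * Y u - Kfun n z c1 c2 a1 a2 a u));
    [|exact ht].
  intros s hs.
  destruct (cartesian_system n z a1 a2 r theta s hn hz (proj1 (hsol s hs))) as [_ hY].
  change (is_derive Y s (- (n - 1) * a1 s * exp (z * X s) * Y s + a2 s)) in hY.
  assert (hreg := solution_regular s hs).
  assert (hsg := is_derive_sigma n z c1 a1 alpha beta a ha ha1 s hreg).
  assert (hK := is_derive_Kfun n z c1 c2 a1 a2 alpha beta a ha ha1 ha2 s hreg).
  rewrite (decay_of_solution s hs), exp_Ropp in hsg.
  auto_derive; [repeat split; eexists; eassumption|].
  rewrite (Derive_eta _ _ _ hY), (Derive_eta _ _ _ hsg), (Derive_eta _ _ _ hK).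
  field; apply Rgt_not_eq, exp_pos. }
assert (hs0 : Defs.sigma n z c1 a1 a a = 0) by exact (RInt_point _ _).
assert (hK0 : Kfun n z c1 c2 a1 a2 a a = c2)
  by (unfold Kfun; rewrite RInt_point; apply Rplus_0_r).
rewrite hs0, hK0, exp_0 in h; unfold c2 in *; lra.
Qed.

Lemma ysol_of_solution (t : R) :
  in_interval alpha beta t -> ysol n z c1 c2 a1 a2 a t = Y t.
Proof.
intro ht; unfold ysol; rewrite (Kfun_of_solution t ht), exp_Ropp.
field; apply Rgt_not_eq, exp_pos.
Qed.

Lemma solution_closed_form :
  exists c1 c2 : R, forall t, in_interval alpha beta t ->
    sol_defined n z c1 c2 a1 a2 a t /\
    admissible_root n z c1 c2 a1 a2 a t /\
    r t = r_sol n z c1 c2 a1 a2 a t /\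
    theta t = theta_sol n z c1 c2 a1 a2 a t.
Proof.
exists c1, c2; intros t ht.
destruct (hsol t ht) as [[hr [hs [hc _]]] hth]; cbv zeta in hs, hc.
assert (hm : n - 1 <> 0) by lra.
assert (hS : 0 < sin ((n - 1) * theta t)) by (apply sin_gt_0; lra).
assert (hC : 0 < cos ((n - 1) * theta t)) by (apply cos_gt_0; lra).
assert (hp := Rpower_pos (r t) (n - 1)).
assert (hx := xsol_of_solution t ht); assert (hy := ysol_of_solution t ht).
assert (hd : sol_defined n z c1 c2 a1 a2 a t).
{ split; [|split].
  - apply (solution_regular t ht).
  - fold (xsol n z c1 a1 a t); rewrite hx.
    apply Rdiv_lt_0_compat; assumption.
  - rewrite (Kfun_of_solution t ht).
    apply Rmult_integral_contrapositive_currified; [apply Rgt_not_eq, exp_pos|].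
    apply Rmult_integral_contrapositive_currified; [lra|].
    apply Rinv_neq_0_compat, Rmult_integral_contrapositive_currified; lra. }
destruct (polar_cart (n - 1) (r t) (theta t) hm hr hth) as [er eth].
split; [exact hd|split; [|split]].
- apply (admissible_root_sign n z c1 c2 a1 a2 a t hn hd); rewrite hx, hy.
  (* The sign condition becomes positivity of the cotangent, which the range assumed for the angle
     provides. *)
  replace (- _) with (cos ((n - 1) * theta t) / sin ((n - 1) * theta t))
    by (unfold X, Y, cart_x, cart_y; field; lra).
  apply Rdiv_lt_0_compat; assumption.
- rewrite r_sol_polar, hx, hy; symmetry; exact er.
- rewrite theta_sol_polar, hx, hy; symmetry; exact eth.
Qed.

End Uniqueness.

(** * The limit [z -> 0] *)

Lemma continuous_bounded_between (f : R -> R) (a t : R) :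
  (forall s, Rmin a t <= s <= Rmax a t -> continuous f s) ->
  exists M, forall s, Rmin a t <= s <= Rmax a t -> Rabs (f s) <= M.
Proof.
intro hf.
destruct (bounded_continuity f (Rmin a t) (Rmax a t) hf) as [M hM].
exists M; intros s hs; apply Rlt_le, (hM s hs).
Qed.

Lemma is_lim_of_linear_bound (f : R -> R) (l C delta : R) :
  0 < delta -> (forall z, Rabs z < delta -> Rabs (f z - l) <= C * Rabs z) ->
  is_lim f 0 l.
Proof.
intros hdelta hf; apply is_lim_spec; intro eps.
(* [Rabs C + 1] dominates [C] and is a positive divisor even when [C] is zero or negative. *)
assert (hC : 0 < Rabs C + 1) by (generalize (Rabs_pos C); lra).
assert (he := cond_pos eps).
assert (hd : 0 < Rmin delta (eps / (Rabs C + 1)))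
  by (apply Rmin_glb_lt; [exact hdelta|apply Rdiv_lt_0_compat; assumption]).
exists (mkposreal _ hd); intros z hz _.
assert (hz' : Rabs z < Rmin delta (eps / (Rabs C + 1))).
{ replace z with (z - 0) by ring; exact hz. }
assert (h1 := Rlt_le_trans _ _ _ hz' (Rmin_l _ _)).
assert (h2 := Rlt_le_trans _ _ _ hz' (Rmin_r _ _)).
apply (Rle_lt_trans _ _ _ (hf z h1)).
apply (Rle_lt_trans _ ((Rabs C + 1) * Rabs z)).
- apply Rmult_le_compat_r; [apply Rabs_pos|generalize (Rle_abs C); lra].
- replace (pos eps) with ((Rabs C + 1) * (eps / (Rabs C + 1))) by (field; lra).
  apply Rmult_lt_compat_l; assumption.
Qed.

(** The quotient is the difference quotient at 0 of [ln (1 - z g)], which vanishes there. *)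
Lemma is_lim_ln_slope (g : R) : is_lim (fun z => ln (1 - z * g) / z) 0 (- g).
Proof.
assert (h : derivable_pt_lim (fun z => ln (1 - z * g)) 0 (- g)).
{ apply is_derive_Reals; auto_derive; [lra|field; lra]. }
apply is_lim_spec; intro eps.
destruct (h eps (cond_pos eps)) as [d hd].
exists d; intros z hz hz0.
assert (hz' : Rabs z < d) by (replace z with (z - 0) by ring; exact hz).
specialize (hd z hz0 hz').
rewrite Rplus_0_l, Rmult_0_l, Rminus_0_r, ln_1, Rminus_0_r in hd; exact hd.
Qed.

Lemma is_lim_Rpower (f : R -> R) (l p : R) :
  0 < l -> is_lim f 0 l -> is_lim (fun z => Rpower (f z) p) 0 (Rpower l p).
Proof.
intros hl hf; apply (is_lim_comp_continuous f (fun y => Rpower y p)); [exact hf|].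
apply (ex_derive_continuous (fun y => Rpower y p)); unfold Rpower; auto_derive; exact hl.
Qed.

Lemma is_lim_mult_finite (f g : R -> R) (lf lg : R) :
  is_lim f 0 lf -> is_lim g 0 lg -> is_lim (fun z => f z * g z) 0 (lf * lg).
Proof. intros hf hg; exact (is_lim_mult f g 0 lf lg hf hg I). Qed.

Lemma is_lim_inv_finite (f : R -> R) (l : R) :
  l <> 0 -> is_lim f 0 l -> is_lim (fun z => / f z) 0 (/ l).
Proof.
intros hl hf; apply (is_lim_comp_continuous f Rinv); [exact hf|].
apply continuous_Rinv, hl.
Qed.

(** * Convergence of the closed form at a fixed time *)

Section UndeformedLimit.
Variables (n c1 c2 : R) (a1 a2 : R -> R) (alpha beta : Rbar) (a t : R).
Hypothesis hn : n <> 1.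
Hypothesis hc1 : 0 < c1.
Hypothesis ha : in_interval alpha beta a.
Hypothesis ha1 : forall t, in_interval alpha beta t -> continuous a1 t.
Hypothesis ha2 : forall t, in_interval alpha beta t -> continuous a2 t.
Hypothesis ht : in_interval alpha beta t.

Lemma continuous_exp_gamma (s : R) :
  in_interval alpha beta s -> continuous (fun u => exp (gamma n a1 a u)) s.
Proof.
intro hs; apply (continuous_comp (gamma n a1 a) exp).
- apply (ex_derive_continuous (gamma n a1 a)); eexists.
  apply (is_derive_gamma n a1 alpha beta a ha ha1 s hs).
- apply (ex_derive_continuous exp); eexists; apply is_derive_exp.
Qed.

(* From [d sigma = d gamma / (1 - z c1 e^gamma)]. *)
Lemma exp_sigma (z s : R) :
  regular n z c1 a1 alpha beta a s ->
  exp (Defs.sigma n z c1 a1 a s)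
  = exp (gamma n a1 a s) * ((1 - z * c1) / decay n z c1 a1 a s).
Proof.
intro hs.
(* This product is conserved: with [d = decay], its logarithmic derivative is
   [(n - 1) a1 (1/d - 1 - (1 - d)/d) = 0]. Its value at [a] is [1 - z c1]. *)
assert (h : exp (Defs.sigma n z c1 a1 a s) * exp (- gamma n a1 a s)
              * decay n z c1 a1 a s
          = exp (Defs.sigma n z c1 a1 a a) * exp (- gamma n a1 a a)
              * decay n z c1 a1 a a).
{ apply (star_derive_zero a (regular n z c1 a1 alpha beta a)
    (star_open_regular n z c1 a1 alpha beta a ha ha1)
    (fun u => exp (Defs.sigma n z c1 a1 a u) * exp (- gamma n a1 a u)
              * decay n z c1 a1 a u)); [|exact hs].
  intros u hu.
  assert (hd := regular_decay n z c1 a1 alpha beta a u hu).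
  assert (hg := is_derive_gamma n a1 alpha beta a ha ha1 u (proj1 hu)).
  assert (hdd := is_derive_decay n z c1 a1 alpha beta a ha ha1 u (proj1 hu)).
  assert (hsg := is_derive_sigma n z c1 a1 alpha beta a ha ha1 u hu).
  auto_derive; [repeat split; eexists; eassumption|].
  rewrite (Derive_eta _ _ _ hg), (Derive_eta _ _ _ hdd), (Derive_eta _ _ _ hsg).
  assert (e : z * c1 * exp (gamma n a1 a u) = 1 - decay n z c1 a1 a u)
    by (unfold decay; ring).
  rewrite e; field; lra. }
assert (hs0 : Defs.sigma n z c1 a1 a a = 0) by exact (RInt_point _ _).
rewrite hs0, gamma_base, decay_base, Ropp_0, exp_0, Rmult_1_l, Rmult_1_l in h.
rewrite <- h, exp_Ropp; field; split; apply Rgt_not_eq;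
  [apply exp_pos|apply (regular_decay n z c1 a1 alpha beta a s hs)].
Qed.

(** [e^gamma] is bounded on the compact segment, so [z c1 e^gamma] is at most one half there for all
    small [z]. The bound is uniform in both [z] and [s], as the limit under the integral
    requires. *)
Lemma decay_lower_bound :
  exists delta, 0 < delta /\ forall z, Rabs z < delta ->
    forall s, Rmin a t <= s <= Rmax a t -> / 2 <= decay n z c1 a1 a s.
Proof.
destruct (continuous_bounded_between (fun u => exp (gamma n a1 a u)) a t) as [V hV].
{ intros s hs; apply continuous_exp_gamma.
  exact (in_interval_between _ _ a t s ha ht hs). }
assert (hV0 : 0 <= V).
{ apply (Rle_trans _ _ _ (Rabs_pos _) (hV a (conj (Rmin_l _ _) (Rmax_l _ _)))). }
assert (hcV : 0 < 2 * (c1 * V + 1)).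
{ assert (h := Rmult_le_pos c1 V (Rlt_le _ _ hc1) hV0); lra. }
(* The [+ 1] makes the divisor positive from [0 <= V] alone. *)
exists (/ (2 * (c1 * V + 1))); split; [apply Rinv_0_lt_compat, hcV|].
intros z hz s hs; unfold decay.
assert (he := exp_pos (gamma n a1 a s)).
assert (hes := hV s hs); cbv beta in hes; rewrite Rabs_pos_eq in hes by lra.
assert (hb : Rabs (z * c1 * exp (gamma n a1 a s)) <= / 2).
{ rewrite !Rabs_mult, (Rabs_pos_eq c1), (Rabs_pos_eq (exp _)) by lra.
  rewrite Rmult_assoc.
  apply (Rle_trans _ (/ (2 * (c1 * V + 1)) * (c1 * V + 1))).
  - apply Rmult_le_compat; [apply Rabs_pos|apply Rmult_le_pos; lra|lra|].
    assert (h := Rmult_le_compat_l c1 _ _ (Rlt_le _ _ hc1) hes); lra.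
  - right; field; lra. }
apply Rabs_le_between in hb; lra.
Qed.

Lemma eventually_regular :
  exists delta, 0 < delta /\ forall z, Rabs z < delta ->
    regular n z c1 a1 alpha beta a t.
Proof.
destruct decay_lower_bound as [delta [hdelta h]].
exists delta; split; [exact hdelta|].
intros z hz; split; [exact ht|].
intros s hs; generalize (h z hz s hs); lra.
Qed.

Lemma locally'_0_Rabs (P : R -> Prop) (delta : R) :
  0 < delta -> (forall z, Rabs z < delta -> P z) -> Rbar_locally' 0 P.
Proof.
intros hd h; exists (mkposreal _ hd); intros z hz _; apply h.
replace z with (z - 0) by ring; exact hz.
Qed.

Lemma is_lim_Lfun :
  is_lim (fun z => Lfun n z c1 a1 a t) 0 (- (c1 * exp (gamma n a1 a t))).
Proof.
apply (is_lim_ext (fun z => ln (1 - z * (c1 * exp (gamma n a1 a t))) / z)).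
- intro z; unfold Lfun; do 3 f_equal; ring.
- apply is_lim_ln_slope.
Qed.

(** For small [z], [exp_sigma] replaces the integral by a rational function of [z] that is
    continuous at 0. *)
Lemma is_lim_exp_sigma :
  is_lim (fun z => exp (Defs.sigma n z c1 a1 a t)) 0 (exp (gamma n a1 a t)).
Proof.
destruct eventually_regular as [delta [hdelta h]].
apply (is_lim_ext_loc (fun z => exp (gamma n a1 a t) * ((1 - z * c1) / decay n z c1 a1 a t))).
- apply (locally'_0_Rabs _ delta hdelta).
  intros z hz; symmetry; apply exp_sigma, h, hz.
- evar_last.
  + apply is_lim_continuity, continuity_pt_filterlim.
    apply (ex_derive_continuous (fun z : R =>
      exp (gamma n a1 a t) * ((1 - z * c1) / decay n z c1 a1 a t))).
    unfold decay; auto_derive; lra.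
  + unfold decay; f_equal; field; lra.
Qed.

(** By [exp_sigma], [e^sigma - e^gamma = z c1 e^gamma (e^gamma - 1) / decay]. The two integrands
    therefore differ by at most [2 |z| c1 M], where [M] bounds [g], and the integrals by [|t - a|]
    times that. *)
Lemma is_lim_Kfun :
  is_lim (fun z => Kfun n z c1 c2 a1 a2 a t) 0 (K0fun n c2 a1 a2 a t).
Proof.
assert (hin := in_interval_between alpha beta a t).
destruct decay_lower_bound as [delta [hdelta hlow]].
set (f := fun u => exp (gamma n a1 a u) * a2 u).
set (g := fun u => f u * (exp (gamma n a1 a u) - 1)).
assert (hf : forall s, in_interval alpha beta s -> continuous f s).
{ intros s hs; apply (continuous_mult (fun u => exp (gamma n a1 a u)) a2).
  - apply continuous_exp_gamma, hs.
  - apply ha2, hs. }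
destruct (continuous_bounded_between g a t) as [M hM].
{ intros s hs; apply (continuous_mult f (fun u => exp (gamma n a1 a u) - 1)).
  - apply hf, hin; assumption.
  - apply (continuous_minus (fun u => exp (gamma n a1 a u)) (fun _ => 1));
      [apply continuous_exp_gamma, hin; assumption|apply continuous_const]. }
apply (is_lim_of_linear_bound _ _ (Rabs (t - a) * (2 * c1 * M)) delta hdelta).
intros z hz.
assert (hreg : regular n z c1 a1 alpha beta a t).
{ split; [exact ht|]; intros s hs; generalize (hlow z hz s hs); lra. }
set (k := fun u => exp (Defs.sigma n z c1 a1 a u) * a2 u).
assert (hk : ex_RInt k a t).
{ apply (star_ex_RInt a _ (star_open_regular n z c1 a1 alpha beta a ha ha1)); [|exact hreg].
  apply (continuous_Kfun_integrand n z c1 a1 a2 alpha beta a ha ha1 ha2). }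
assert (hf' : ex_RInt f a t)
  by (apply (star_ex_RInt a _ (star_open_interval _ _ _ ha)); assumption).
unfold Kfun, K0fun; fold k; fold f.
replace (c2 + RInt k a t - (c2 + RInt f a t)) with (RInt k a t - RInt f a t) by ring.
replace (_ * Rabs z) with (Rabs (t - a) * (2 * Rabs z * c1 * M)) by ring.
apply (norm_RInt_le_const_abs (fun u => minus (k u) (f u)) a t
  (minus (RInt k a t) (RInt f a t))).
- intros s hs.
  assert (hds := hlow z hz s hs).
  assert (hregs := proj1 (star_open_regular n z c1 a1 alpha beta a ha ha1 t hreg) s hs).
  replace (minus (k s) (f s)) with (z * c1 * g s * / decay n z c1 a1 a s).
  + change norm with Rabs.
    rewrite !Rabs_mult, Rabs_inv, (Rabs_pos_eq c1), (Rabs_pos_eq (decay _ _ _ _ _ _)) by lra.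
    assert (hg : 0 <= Rabs z * c1 * Rabs (g s))
      by (repeat apply Rmult_le_pos; try apply Rabs_pos; lra).
    apply (Rle_trans _ (Rabs z * c1 * Rabs (g s) * 2)).
    * apply Rmult_le_compat_l; [exact hg|].
      rewrite <- (Rinv_inv 2); apply Rinv_le_contravar; lra.
    * assert (h := Rmult_le_compat_l (Rabs z * c1) _ _
        (Rmult_le_pos _ _ (Rabs_pos z) (Rlt_le _ _ hc1)) (hM s hs)).
      lra.
  + unfold k, g, f; rewrite exp_sigma by exact hregs.
    unfold minus, plus, opp; simpl.
    revert hds; unfold decay; intro hds; field; lra.
- apply (is_RInt_minus k f); apply (RInt_correct (V := R_CompleteNormedModule)); assumption.
Qed.

Lemma is_lim_r_sol :
  is_lim (fun z => r_sol n z c1 c2 a1 a2 a t) 0 (r_undeformed n c1 c2 a1 a2 a t).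
Proof.
assert (hL := is_lim_Lfun); assert (hS := is_lim_exp_sigma); assert (hK := is_lim_Kfun).
assert (he := exp_pos (gamma n a1 a t)).
set (e := exp (gamma n a1 a t)) in *; set (K0 := K0fun n c2 a1 a2 a t) in *.
assert (hce : 0 < c1 * e) by (apply Rmult_lt_0_compat; assumption).
(* Limit of [(n - 1) L e^(-sigma) K]; the factor [e] cancels, leaving [- (n - 1) c1 K0]. *)
set (LK := (n - 1) * (- (c1 * e)) * / e * K0).
assert (hD := one_plus_sq_pos LK).
assert (hw : is_lim (fun z => (n - 1) * Lfun n z c1 a1 a t * / exp (Defs.sigma n z c1 a1 a t)
                     * Kfun n z c1 c2 a1 a2 a t) 0 LK).
{ apply is_lim_mult_finite; [|exact hK].
  apply is_lim_mult_finite; [|apply is_lim_inv_finite; [lra|exact hS]].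
  apply is_lim_mult_finite; [apply is_lim_const|exact hL]. }
(* The factor [e^(-2 sigma)] is absorbed into the square, so that the limit [hw] applies
   directly. *)
apply (is_lim_ext (fun z => Rpower (- Lfun n z c1 a1 a t) (1 / (n - 1)) *
  Rpower (1 + ((n - 1) * Lfun n z c1 a1 a t * / exp (Defs.sigma n z c1 a1 a t)
                     * Kfun n z c1 c2 a1 a2 a t) ^ 2) (- 1 / (2 * (n - 1))))).
- intro z; unfold r_sol; cbv zeta; do 2 f_equal.
  replace (-2 * Defs.sigma n z c1 a1 a t)
    with (- Defs.sigma n z c1 a1 a t + - Defs.sigma n z c1 a1 a t) by ring.
  rewrite exp_plus, exp_Ropp; ring.
- evar_last.
  + apply is_lim_mult_finite.
    * apply is_lim_Rpower; [exact hce|].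
      rewrite <- (Ropp_involutive (c1 * e)); exact (is_lim_opp _ _ _ hL).
    * apply (is_lim_Rpower _ _ _ hD).
      apply (is_lim_comp_continuous _ (fun y => 1 + y ^ 2) 0 LK hw).
      apply (ex_derive_continuous (fun y : R => 1 + y ^ 2)); auto_derive; exact I.
  + unfold r_undeformed; fold e; fold K0; f_equal.
    replace ((n - 1) ^ 2 * c1 ^ 2 * K0 ^ 2) with (LK ^ 2) by (unfold LK; field; lra).
    (* The inverse square root becomes the power [-1/2], which combines with the exponent
       [1 / (n - 1)]. *)
    rewrite <- (Rpower_sqrt _ hD).
    unfold Rdiv at 3; rewrite <- Rpower_Ropp.
    rewrite <- (Rpower_mult_distr (c1 * e)) by (exact hce || apply Rpower_pos).
    rewrite Rpower_mult; do 2 f_equal; field; lra.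
Qed.

Lemma is_lim_theta_sol :
  K0fun n c2 a1 a2 a t <> 0 ->
  is_lim (fun z => theta_sol n z c1 c2 a1 a2 a t) 0
    (theta_undeformed n c1 c2 a1 a2 a t).
Proof.
intro hK0.
assert (hL := is_lim_Lfun); assert (hS := is_lim_exp_sigma); assert (hK := is_lim_Kfun).
assert (he := exp_pos (gamma n a1 a t)).
unfold theta_undeformed.
set (e := exp (gamma n a1 a t)) in *; set (K0 := K0fun n c2 a1 a2 a t) in *.
assert (hce : 0 < c1 * e) by (apply Rmult_lt_0_compat; assumption).
(* The limit is put in the shape inherited from [theta_sol]: [e] appears in the numerator and in the
   limit of [L], and the minus sign goes inside by oddness of [atan]. *)
replace (- (1 / (n - 1)) * atan (1 / ((n - 1) * c1 * K0)))
  with (1 / (n - 1) * atan (e * / ((n - 1) * - (c1 * e) * K0))).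
- apply is_lim_mult_finite; [apply is_lim_const|].
  apply (is_lim_comp_continuous
    (fun z => exp (Defs.sigma n z c1 a1 a t) *
      / ((n - 1) * Lfun n z c1 a1 a t * Kfun n z c1 c2 a1 a2 a t)) atan).
  + apply is_lim_mult_finite; [exact hS|].
    apply is_lim_inv_finite.
    * apply Rmult_integral_contrapositive_currified; [|exact hK0].
      apply Rmult_integral_contrapositive_currified; lra.
    * apply is_lim_mult_finite; [|exact hK].
      apply is_lim_mult_finite; [apply is_lim_const|exact hL].
  + apply (ex_derive_continuous atan); auto_derive; exact I.
- replace (e * / ((n - 1) * - (c1 * e) * K0)) with (- (1 / ((n - 1) * c1 * K0)))
    by (field; repeat split; try assumption; lra).
  rewrite atan_opp; ring.
Qed.

End UndeformedLimit.

Theorem mainTheorem5 (n : R) (a1 a2 : R -> R) (alpha beta : Rbar) (a : R)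
  (hn0 : n <> 0) (hn1 : n <> 1)
  (ha : in_interval alpha beta a)
  (ha1 : forall t, in_interval alpha beta t -> continuous a1 t)
  (ha2 : forall t, in_interval alpha beta t -> continuous a2 t) :
  (* the expressions solve the system, with the admissible square root *)
  (forall z c1 c2 t : R, z <> 0 -> in_interval alpha beta t ->
     sol_defined n z c1 c2 a1 a2 a t ->
     admissible_root n z c1 c2 a1 a2 a t ->
     deformed_bernoulli_at n z a1 a2
       (r_sol n z c1 c2 a1 a2 a) (theta_sol n z c1 c2 a1 a2 a) t) /\
  (* no other square root is admissible; where a1 and a2 both vanish the
     system only says that r and theta are stationary *)
  (forall z c1 c2 t : R, z <> 0 -> in_interval alpha beta t ->
     sol_defined n z c1 c2 a1 a2 a t ->
     a1 t <> 0 \/ a2 t <> 0 ->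
     deformed_bernoulli_at n z a1 a2
       (r_sol n z c1 c2 a1 a2 a) (theta_sol n z c1 c2 a1 a2 a) t ->
     admissible_root n z c1 c2 a1 a2 a t) /\
  (* every solution in the range of the expressions is of this form *)
  (forall (z : R) (r theta : R -> R), z <> 0 ->
     (forall t, in_interval alpha beta t ->
        deformed_bernoulli_at n z a1 a2 r theta t /\
        0 < (n - 1) * theta t < PI / 2) ->
     exists c1 c2 : R, forall t, in_interval alpha beta t ->
       sol_defined n z c1 c2 a1 a2 a t /\
       admissible_root n z c1 c2 a1 a2 a t /\
       r t = r_sol n z c1 c2 a1 a2 a t /\
       theta t = theta_sol n z c1 c2 a1 a2 a t) /\
  (* limit z -> 0; c1 > 0 makes the undeformed radius a real power of a
     positive number *)
  (forall c1 c2 t : R, in_interval alpha beta t -> 0 < c1 ->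
     is_lim (fun z => r_sol n z c1 c2 a1 a2 a t) 0
       (r_undeformed n c1 c2 a1 a2 a t) /\
     (K0fun n c2 a1 a2 a t <> 0 ->
      is_lim (fun z => theta_sol n z c1 c2 a1 a2 a t) 0
        (theta_undeformed n c1 c2 a1 a2 a t))).
Proof.
split; [|split; [|split]].
- intros z c1 c2 t hz ht hd hadm.
  exact (closed_form_solves n z c1 c2 a1 a2 alpha beta a ha ha1 ha2 t hn1 hz ht hd hadm).
- intros z c1 c2 t hz ht hd hne hsys.
  exact (solution_admissible n z c1 c2 a1 a2 alpha beta a ha ha1 ha2 t hn1 hz ht hd hne hsys).
- intros z r theta hz hsol.
  exact (solution_closed_form n z a1 a2 alpha beta a r theta hn1 hz ha ha1 ha2 hsol).
- intros c1 c2 t ht hc1; split.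
  + exact (is_lim_r_sol n c1 c2 a1 a2 alpha beta a t hn1 hc1 ha ha1 ha2 ht).
  + exact (is_lim_theta_sol n c1 c2 a1 a2 alpha beta a t hn1 hc1 ha ha1 ha2 ht).
Qed.
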